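(* For $n\ge 3$ and a real symmetric $n\times n$ matrix $D$ with $D_{ij}=D_{ji}>0$ for $i\ne j$, let $\mathrm{LP}(D)$ and $\mathrm{SDP}(D)$ denote the optimal values of the following two programs, where $d=\lfloor n/2\rfloor$. (LP) Minimize $\tfrac12\operatorname{trace}(DX)$ over real symmetric $n\times n$ matrices $X$ subject to $$Xe=2e,\qquad \operatorname{diag}(X)=0,\qquad 0\le X\le J,\qquad \sum_{i\in\mathcal{I},\,j\notin\mathcal{I}}X_{ij}\ge 2\ \text{ for all } \emptyset\ne\mathcal{I}\subsetneq\{1,\ldots,n\}.$$ (SDP) Minimize $\tfrac12\operatorname{trace}\left(DX^{(1)}\right)$ over real symmetric $n\times n$ matrices $X^{(1)},\ldots,X^{(d)}$ subject to $$X^{(k)}\ge 0\ \ (k=1,\ldots,d),\qquad \sum_{k=1}^d X^{(k)}=J-I,\qquad I+\sum_{k=1}^d\cos\left(\frac{2\pi i k}{n}\right)X^{(k)}\succeq 0\ \ (i=1,\ldots,d).$$ Then neither relaxation dominates the other: there exist $n\ge 3$ and such an $n\times n$ matrix $D$ with $\mathrm{LP}(D)<\mathrm{SDP}(D)$, and there exist $n'\ge 3$ and such an $n'\times n'$ matrix $D'$ with $\mathrm{SDP}(D')<\mathrm{LP}(D')$.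
   Context: $I$ and $J$ denote the $n\times n$ identity and all-ones matrices, and $e\in\mathbb{R}^n$ is the all-ones vector. Inequalities $\ge,\le$ between matrices are entrywise, and $M\succeq 0$ means that $M$ is symmetric positive semidefinite. $\operatorname{diag}(X)$ is the vector of diagonal entries of $X$. Both programs are relaxations (giving lower bounds) of the symmetric traveling salesman problem on $n$ cities with edge length matrix $D$. One such relaxation dominates another if, for every instance, its lower bound is at least as large as that of the other. The program (LP) is the sub-tour elimination relaxation, whose value is known as the Held-Karp bound. *)

(* Defs.v *)
From mathcomp Require Import all_boot all_order all_algebra.
From mathcomp Require Import classical_sets reals ereal trigo.

Set Implicit Arguments.
Unset Strict Implicit.
Unset Printing Implicit Defensive.

Import Order.TTheory GRing.Theory Num.Theory.
Local Open Scope ring_scope.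

Definition symmetric_mx (R : realType) (n : nat) (A : 'M[R]_n) : Prop :=
  A^T = A.

Definition mx_le (R : realType) (m n : nat) (A B : 'M[R]_(m, n)) : Prop :=
  forall i j, A i j <= B i j.

Definition psd_mx (R : realType) (n : nat) (A : 'M[R]_n) : Prop :=
  symmetric_mx A /\ forall x : 'cV[R]_n, 0 <= (x^T *m A *m x) 0 0.

Definition tsp_lengths (R : realType) (n : nat) (D : 'M[R]_n) : Prop :=
  symmetric_mx D /\ forall i j : 'I_n, i != j -> 0 < D i j.

Definition ones_mx (R : realType) (m n : nat) : 'M[R]_(m, n) := const_mx 1.
Arguments ones_mx {R m n}.

Definition LP_feasible (R : realType) (n : nat) (X : 'M[R]_n) : Prop :=
  [/\ symmetric_mx X,
      X *m (ones_mx : 'cV[R]_n) = 2 *: ones_mx,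
      forall i, X i i = 0,
      mx_le 0 X /\ mx_le X ones_mx &
      forall S : {set 'I_n}, S != finset.set0 -> S \proper finset.setT ->
        2 <= \sum_(i in S) \sum_(j | j \notin S) X i j].

(* Indices are shifted: for [k : 'I_(n./2)], [X k] is the matrix X^(k+1); the
   index i of the semidefinite constraints is shifted in the same way. *)
Definition SDP_feasible (R : realType) (n : nat)
    (X : 'I_(n./2) -> 'M[R]_n) : Prop :=
  [/\ forall k, symmetric_mx (X k),
      forall k, mx_le 0 (X k),
      \sum_k X k = ones_mx - 1%:M &
      forall i : 'I_(n./2),
        psd_mx (1%:M + \sum_(k < n./2)
                  cos (2 * pi * i.+1%:R * k.+1%:R / n%:R) *: X k)].

Definition tour_cost (R : realType) (n : nat) (D X : 'M[R]_n) : R :=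
  2^-1 * \tr (D *m X).

Local Open Scope classical_set_scope.

(* Optimal values are infima in the extended reals, so that they need no
   convention for infeasible or unbounded programs. *)
Definition LP (R : realType) (n : nat) (D : 'M[R]_n) : \bar R :=
  ereal_inf [set (tour_cost D X)%:E | X in [set X | LP_feasible X]].

(* The objective only involves X^(1), which has index 0 in ['I_(n./2)]; the
   equation [k = 0 :> nat] makes sense for every n, and singles out exactly one
   [k] as soon as n >= 2. *)
Definition SDP (R : realType) (n : nat) (D : 'M[R]_n) : \bar R :=
  ereal_inf [set v | exists X : 'I_(n./2) -> 'M[R]_n, SDP_feasible X /\
    exists2 k : 'I_(n./2), k = 0%N :> nat & v = (tour_cost D (X k))%:E].

(* Main.v *)
Require Import Defs.
From mathcomp Require Import all_boot all_order all_algebra.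
From mathcomp Require Import classical_sets reals ereal.
From mathcomp Require Import trigo ring lra.

(** Each half is witnessed by one explicit instance.

    SDP below LP. Take two triangles on six cities, with length 1 inside a
    triangle and 2 between the triangles. The degree constraints turn the cost
    of a point of (LP) into 6 plus the weight crossing between the triangles,
    and the sub-tour constraint makes that weight at least 2, so LP is at
    least 8. The semidefinite program controls this cut only through
    eigenvalues, and lets the crossing weight drop to 3/2: there is a feasible
    point of cost 15/2 whose matrices all lie in the span of I and of the
    three relations same triangle, matched vertices and remaining pairs. On
    this span positive semidefiniteness amounts to the nonnegativity of four
    eigenvalues ([psd_prism_mx], [SDP_feasible_triangles]).

    LP below SDP. Take three paths with three vertices each on nine cities,
    whose three left ends form a triangle, and likewise the right ends (the
    two caps): a theta graph with its branch points blown up to triangles.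
    Edges of this graph have length 1, all other pairs length 2. Weight 1 on
    path edges and 1/2 on cap edges is feasible for (LP) and costs 9. It is
    not the first matrix of a feasible point of (SDP), and this fails by a
    definite margin. Let Z_f be the matrix of the f-th semidefinite
    constraint, a Gram matrix in which X^(k) contributes the cosine of f*k
    ninths of a turn. Only averages over the orbits of pairs of vertices under
    the symmetries of the graph matter, and for each orbit the averages of
    X^(1), ..., X^(4) form a probability distribution on the distances 1, ...,
    4. If the cost is below 9 + e, then:
    - path edges are at distance 1 up to O(e), so positivity of Z_1 on the
      second differences along the paths puts the two ends of a path at
      distance 2 ([path_ends_step]);
    - hence in each Z_f the three vectors of a path nearly lie in a plane and
      turn by the angle of frequency f. The rows of Z_f sum to zero, so the
      three middle vectors nearly cancel for f = 1, 2, 4, which puts the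
      middles pairwise at distance 3 ([mid_mid_freq]);
    - the row sums of X^(2) then leave no room for two ends of different paths
      to be at distance 2;
    - the positivity of Z_3 and of Z_4 on the vector that is 1 on one cap and
      -1 on the other are now contradictory ([orientation_step]): the first
      bounds from above, and the second from below, how much oftener ends in
      opposite caps are at distance 3 than ends in the same cap.

    All errors are linear in e, and e = 1/10000 is small enough.

    These arguments use that all row sums of X^(k) are 2 ([SDP9_rows]): the
    nonnegative values of the constraint matrices at the all-ones vector have
    a positive combination equal to 0, so they vanish, hence the all-ones
    vector is in the kernel of each Z_f, and inverting the cosine transform
    gives the row sums. *)

Set Implicit Arguments.
Unset Strict Implicit.
Unset Printing Implicit Defensive.

Import Order.TTheory GRing.Theory Num.Theory.
Local Open Scope ring_scope.

(** * Cosines of fractions of a turn *)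

Definition turn_cos (R : realType) (n j : nat) : R :=
  cos (2 * pi * j%:R / n%:R).

Lemma turn_cos0 (R : realType) n : turn_cos R n 0 = 1.
Proof. by rewrite /turn_cos mulr0 mul0r cos0. Qed.

Lemma turn_cosD (R : realType) n j : (0 < n)%N ->
  turn_cos R n (n + j) = turn_cos R n j.
Proof.
move=> n0; rewrite /turn_cos natrD mulrDr mulrDl.
rewrite mulfK ?pnatr_eq0 -?lt0n // addrC.
have -> : 2 * pi = pi *+ 2 :> R by rewrite mulr_natl.
exact: cosD2pi.
Qed.

Lemma turn_cosB (R : realType) n j : (j <= n)%N -> (0 < n)%N ->
  turn_cos R n (n - j) = turn_cos R n j.
Proof.
move=> jn n0; rewrite /turn_cos natrB // mulrBr mulrBl.
rewrite mulfK ?pnatr_eq0 -?lt0n // -cosN opprB [2 * pi]mulr_natl.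
by rewrite -[LHS]cosD2pi subrK.
Qed.

Lemma turn_cosM (R : realType) n i j : (j <= i)%N ->
  2 * turn_cos R n i * turn_cos R n j
    = turn_cos R n (i + j) + turn_cos R n (i - j).
Proof.
move=> ji; rewrite /turn_cos natrD natrB //.
move: (2 * pi) => t; rewrite mulrDr mulrBr mulrDl mulrBl cosD cosB; ring.
Qed.

Lemma turn_cos_lt (R : realType) n i j : (i < j)%N -> (j.*2 <= n)%N ->
  turn_cos R n j < turn_cos R n i.
Proof.
move=> ij jn.
have n0 : 0 < n%:R :> R by rewrite ltr0n; case: n jn ij => [|//]; case: j.
have angle k : (k.*2 <= n)%N ->
    (2 * pi * k%:R / n%:R : R) \in `[0, pi].
  move=> kn; rewrite in_itv /= divr_ge0 ?mulr_ge0 ?pi_ge0 ?ler0n //=.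
  rewrite ler_pdivrMr // [2 * _]mulrC -mulrA ler_pM2l ?pi_gt0 //.
  by rewrite -natrM ler_nat mul2n.
rewrite /turn_cos ltr_cos ?angle //; last first.
  by apply: leq_trans jn; rewrite leq_double ltnW.
by rewrite ltr_pM2r ?invr_gt0 // ltr_pM2l ?ltr_nat // mulr_gt0 ?pi_gt0.
Qed.

Lemma turn_cos_double (R : realType) n f :
  turn_cos R n (f * 2) = 2 * turn_cos R n f ^+ 2 - 1.
Proof.
have := turn_cosM R n (leqnn f); rewrite subnn turn_cos0 addnn -muln2 expr2.
by rewrite mulrA => ->; rewrite addrK.
Qed.

(** Since the cosine of half a turn is -1, the addition formula makes the first
    cosine c a root of (c + 1) (2 c - 1)^2; strict monotonicity excludes -1. *)
Lemma turn_cos6 (R : realType) :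
  [/\ turn_cos R 6 1 = 1 / 2, turn_cos R 6 2 = - 1 / 2 & turn_cos R 6 3 = - 1].
Proof.
have c3 : turn_cos R 6 3 = -1.
  by rewrite /turn_cos -cospi; congr cos; lra.
have h11 : 2 * turn_cos R 6 1 * turn_cos R 6 1 = turn_cos R 6 2 + 1.
  by rewrite turn_cosM // turn_cos0.
have h21 : 2 * turn_cos R 6 2 * turn_cos R 6 1
    = turn_cos R 6 3 + turn_cos R 6 1 by rewrite turn_cosM.
have lt13 : turn_cos R 6 3 < turn_cos R 6 1 by exact: turn_cos_lt.
move: (turn_cos R 6 1) (turn_cos R 6 2) h11 h21 lt13.
rewrite c3 => x y h11 h21 gtx.
have /eqP : (x + 1) * (2 * x - 1) ^+ 2 = 0.
  have h : 2 * (2 * x * x - 1) * x = -1 + x by rewrite h11 addrK.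
  transitivity (2 * (2 * x * x - 1) * x - x + 1); [ring|lra].
rewrite mulf_eq0 sqrf_eq0 => /orP[]/eqP xE; first lra.
have {}xE : x = 1 / 2 by lra.
by split=> //; rewrite xE in h11; lra.
Qed.

(** The product formula gives [8 a^3 - 6 a + 1 = 0], whose three roots are [a],
    [b] and [d]; their order singles out the largest one. *)
Lemma turn_cos9 (R : realType) (a := turn_cos R 9 1) (b := turn_cos R 9 2)
    (d := turn_cos R 9 4) :
  [/\ turn_cos R 9 3 = - 1 / 2, b = 2 * a ^+ 2 - 1, d = - a - b &
      19 / 25 < a < 10 / 13].
Proof.
have c6 : turn_cos R 9 6 = turn_cos R 9 3 by rewrite -(@turn_cosB R 9 3).
have h33 : 2 * turn_cos R 9 3 * turn_cos R 9 3 = turn_cos R 9 3 + 1.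
  by rewrite turn_cosM // c6 turn_cos0.
have c3 : turn_cos R 9 3 = - 1 / 2.
  have := @turn_cos_lt R 9 0 3 isT isT; rewrite turn_cos0 => lt1.
  have /eqP : (2 * turn_cos R 9 3 + 1) * (turn_cos R 9 3 - 1) = 0.
    transitivity (2 * turn_cos R 9 3 * turn_cos R 9 3 - turn_cos R 9 3 - 1).
      by ring.
    by rewrite h33; ring.
  by rewrite mulf_eq0 => /orP[]/eqP; lra.
have h11 : 2 * a * a = b + 1 by rewrite /a turn_cosM // turn_cos0.
have h21 : 2 * b * a = - 1 / 2 + a by rewrite /a /b turn_cosM // c3.
have h31 : 2 * (- 1 / 2) * a = d + b by rewrite -c3 /a turn_cosM.
have ltab : b < a by exact: turn_cos_lt.
have ltdb : d < b by exact: turn_cos_lt.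
have lta : - 1 / 2 < a by rewrite -c3; exact: turn_cos_lt.
move: a b d h11 h21 h31 ltab ltdb lta => a b d h11 h21 h31 ltab ltdb lta.
have bE : b = 2 * a ^+ 2 - 1 by rewrite expr2; lra.
have dE : d = - a - b by lra.
rewrite bE in h21 ltab ltdb dE *.
have a59 : 1 / 2 < a by nra.
split=> //; apply/andP; split; nra.
Qed.

(** * Quadratic forms, costs and row sums *)

Lemma quad_formE (R : realType) n (M : 'M[R]_n) (x y : 'cV[R]_n) :
  (x^T *m M *m y) 0 0 = \sum_i \sum_j x i 0 * M i j * y j 0.
Proof.
rewrite mxE exchange_big; apply: eq_bigr => j _ /=.
by rewrite mxE mulr_suml; apply: eq_bigr => i _; rewrite mxE.
Qed.

Lemma tour_costE (R : realType) n (D X : 'M[R]_n) : symmetric_mx X ->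
  tour_cost D X = 2^-1 * \sum_i \sum_j D i j * X i j.
Proof.
move=> sX; rewrite /tour_cost /mxtrace; congr (_ * _); apply: eq_bigr => i _.
by rewrite mxE; apply: eq_bigr => j _; rewrite -[in LHS]sX mxE.
Qed.

(** If the form vanishes at [x], its value at [t x + y] is affine in [t], so
    its slope, which is the pairing of [y] with [M x], is zero. *)
Lemma psd_null (R : realType) n (M : 'M[R]_n) (x : 'cV[R]_n) :
  psd_mx M -> (x^T *m M *m x) 0 0 = 0 -> M *m x = 0.
Proof.
move=> [sM pM] x0; apply/matrixP => i j; rewrite (ord1 j) [RHS]mxE => {j}.
pose y := delta_mx i 0 : 'cV[R]_n.
set b := (M *m x) i 0.
have yxE : (y^T *m M *m x) 0 0 = b.
  by rewrite -mulmxA /y trmx_delta -rowE mxE.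
have xyE : (x^T *m M *m y) 0 0 = b.
  have -> : x^T *m M *m y = (y^T *m M *m x)^T.
    by rewrite !trmx_mul trmxK sM mulmxA.
  by rewrite mxE.
set c := (y^T *m M *m y) 0 0.
have lin t : 0 <= 2 * t * b + c.
  have := pM (t *: x + y).
  have -> : (t *: x + y)^T = t *: x^T + y^T.
    by apply/matrixP => ? ?; rewrite !mxE.
  rewrite !mulmxDl !mulmxDr -!scalemxAl -!scalemxAr.
  rewrite /c; move: x0 yxE xyE; move: (b) (x^T *m M *m x) (x^T *m M *m y).
  move: (y^T *m M *m x) (y^T *m M *m y) => yx yy b' xx xy xx0 yxb xyb.
  rewrite !mxE xx0 yxb xyb => h.
  by move: h; congr (_ <= _); ring.
have [//|bn0] := eqVneq b 0.
have := lin (- (c + 1) / (2 * b)).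
have -> : 2 * (- (c + 1) / (2 * b)) * b + c = -1 by field.
by rewrite ler0N1.
Qed.

Lemma LP_feasible_row (R : realType) n (X : 'M[R]_n) i :
  LP_feasible X -> \sum_j X i j = 2.
Proof.
case=> _ /matrixP/(_ i 0) + _ _ _; rewrite !mxE mulr1 => <-.
by apply: eq_bigr => j _; rewrite mxE mulr1.
Qed.

(** * Two triangles: the semidefinite bound is smaller *)

(** The vertices of the triangular prism are numbered so that [i %/ 3] is the
    triangle of [i] and [i %% 3] its position there: [p] is the diagonal entry,
    [a] the entry inside a triangle, [b] the entry along the matching and [c]
    the entry of the remaining pairs. *)
Definition prism_mx (R : realType) (p a b c : R) : 'M[R]_6 :=
  \matrix_(i, j)
    if (i %/ 3 == j %/ 3)%N then (if i == j :> nat then p else a)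
    else if (i %% 3 == j %% 3)%N then b else c.

Lemma sym_prism_mx (R : realType) (p a b c : R) :
  symmetric_mx (prism_mx p a b c).
Proof.
apply/matrixP => i j; rewrite !mxE [(j %/ 3)%N == _]eq_sym.
by rewrite [(j %% 3)%N == _]eq_sym [(j : nat) == _]eq_sym.
Qed.

(** The hypotheses bound the four eigenvalues: the first two belong to the
    vectors constant on each triangle (equal or opposite on the two triangles),
    the last two to the vectors of sum zero on each triangle. *)
Lemma psd_prism_mx (R : realType) (p a b c : R) :
  0 <= p + 2 * a + b + 2 * c -> 0 <= p + 2 * a - b - 2 * c ->
  0 <= p - a + b - c -> 0 <= p - a - b + c -> psd_mx (prism_mx p a b c).
Proof.
move=> h1 h2 h3 h4; split; first exact: sym_prism_mx.
move=> x; rewrite quad_formE !big_ord_recl !big_ord0 !mxE /=.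
move: (x _ 0) (x _ 0) (x _ 0) (x _ 0) (x _ 0) (x _ 0) => x0 x1 x2 x3 x4 x5.
set q := (X in 0 <= X).
have -> : q =
    (p + 2 * a + b + 2 * c) / 6 * (x0 + x1 + x2 + x3 + x4 + x5) ^+ 2
  + (p + 2 * a - b - 2 * c) / 6 * (x0 + x1 + x2 - x3 - x4 - x5) ^+ 2
  + (p - a + b - c) / 6 * ((x0 + x3 - x1 - x4) ^+ 2
      + (x0 + x3 - x2 - x5) ^+ 2 + (x1 + x4 - x2 - x5) ^+ 2)
  + (p - a - b + c) / 6 * ((x0 - x3 - x1 + x4) ^+ 2
      + (x0 - x3 - x2 + x5) ^+ 2 + (x1 - x4 - x2 + x5) ^+ 2).
  by rewrite /q; field.
have sq3 (u v w : R) : 0 <= u ^+ 2 + v ^+ 2 + w ^+ 2.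
  by rewrite !addr_ge0 ?sqr_ge0.
apply: addr_ge0; [apply: addr_ge0; [apply: addr_ge0|]|];
  by apply: mulr_ge0; [apply: divr_ge0 | by [exact: sqr_ge0 | exact: sq3]].
Qed.

Definition triangles_lengths (R : realType) : 'M[R]_6 := prism_mx 0 1 2 2.

(** Within the span of the prism matrices, feasibility is a linear program;
    this is a solution maximizing the weight 3/4 of the triangle edges in the
    first matrix. Weight 1/2 is then left for each vertex to cross. *)
Definition triangles_sdp (R : realType) (k : 'I_3) : 'M[R]_6 :=
  if k == 0 :> nat then prism_mx 0 (3 / 4) (1 / 2) 0
  else if k == 1 :> nat then prism_mx 0 (1 / 4) (1 / 2) (1 / 2)
  else prism_mx 0 0 0 (1 / 2).

Lemma SDP_feasible_triangles (R : realType) :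
  @SDP_feasible R 6 (@triangles_sdp R).
Proof.
split.
- move=> k; rewrite /triangles_sdp.
  by do 2?[case: ifP => _]; apply: sym_prism_mx.
- move=> k i j; rewrite /triangles_sdp !mxE.
  by do 2?[case: ifP => _]; rewrite !mxE; do 3?[case: ifP => _]; lra.
- rewrite !big_ord_recl big_ord0 /triangles_sdp /= addr0.
  apply/matrixP => i j; rewrite !mxE -val_eqE /=.
  by do 3?[case: eqP => ? /=]; rewrite ?mulr1n ?mulr0n; try lra; congruence.
- have [c1 c2 c3] := turn_cos6 R.
  have c4 : turn_cos R 6 4 = - 1 / 2 by rewrite (@turn_cosB R 6 2).
  have c6 : turn_cos R 6 6 = 1 by rewrite (@turn_cosD R 6 0) ?turn_cos0.
  have c9 : turn_cos R 6 9 = -1 by rewrite (@turn_cosD R 6 3).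
  have cE (f m : nat) :
      cos (2 * pi * f%:R * m%:R / 6%:R) = turn_cos R 6 (f * m).
    by rewrite /turn_cos natrM mulrA.
  have lin (p0 a0 b0 c0 p1 a1 b1 c1' p2 a2 b2 c2' u v w : R) :
     1%:M + (u *: prism_mx p0 a0 b0 c0 + (v *: prism_mx p1 a1 b1 c1' +
       (w *: prism_mx p2 a2 b2 c2' + 0))) =
     prism_mx (1 + u * p0 + v * p1 + w * p2) (u * a0 + v * a1 + w * a2)
       (u * b0 + v * b1 + w * b2) (u * c0 + v * c1' + w * c2').
    apply/matrixP => r s; rewrite !mxE -val_eqE /=.
    by do 3?[case: eqP => ? /=]; rewrite ?mulr1n ?mulr0n; try ring; congruence.
  case=> [[|[|[|//]]]] hi; rewrite !big_ord_recl big_ord0 /triangles_sdp /= !cE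
    /= ?c1 ?c2 ?c3 ?c4 ?c6 ?c9 lin; apply: psd_prism_mx; lra.
Qed.

Lemma tsp_lengths_triangles (R : realType) : tsp_lengths (triangles_lengths R).
Proof.
split=> [|i j ij]; first exact: sym_prism_mx.
rewrite mxE; move: ij; rewrite -val_eqE => /negbTE ->.
by do 2?[case: ifP => ?]; lra.
Qed.

Lemma SDP_triangles_le (R : realType) :
  (SDP (triangles_lengths R) <= (15 / 2 : R)%:E)%E.
Proof.
apply: ereal_inf_lbound; exists (@triangles_sdp R).
split; first exact: SDP_feasible_triangles.
exists ord0 => //; congr EFin; rewrite tour_costE; last exact: sym_prism_mx.
rewrite !big_ord_recl !big_ord0 !mxE /=; lra.
Qed.

(** Each row of [X] sums to 2, and crossing edges are charged once more: the
    cost is 6 plus the weight cut by the first triangle. *)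
Lemma LP_triangles_ge (R : realType) :
  ((8 : R)%:E <= LP (triangles_lengths R))%E.
Proof.
apply: le_ereal_inf_tmp => _ /= [X fX <-]; rewrite lee_fin.
have [sX _ _ _ cutX] := fX.
rewrite tour_costE //.
pose A := [set i : 'I_6 | (i < 3)%N]%SET.
have A0 : A != finset.set0.
  by apply/set0Pn; exists ord0; rewrite inE.
have AT : A \proper [set: 'I_6].
  rewrite properE finset.subsetT /=.
  by apply/subsetPn; exists ord_max; rewrite !inE.
have := cutX A A0 AT.
(* [cut] counts a crossing edge only from its end in the first triangle. *)
pose cut (i j : 'I_6) := ((i < 3) && ~~ (j < 3) : nat)%N%:R * X i j.
have -> : \sum_(i in A) \sum_(j | j \notin A) X i j = \sum_i \sum_j cut i j.
  rewrite big_mkcond; apply: eq_bigr => i _; rewrite inE /cut.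
  case: ltnP => _; last by rewrite big1 // => j _; rewrite mul0r.
  rewrite big_mkcond; apply: eq_bigr => j _; rewrite inE.
  by case: ltnP => _; rewrite ?mul0r ?mul1r.
have cost_entry i j :
    triangles_lengths R i j * X i j = X i j + cut i j + cut j i.
  have -> : cut j i = ((j < 3) && ~~ (i < 3) : nat)%N%:R * X i j.
    by rewrite /cut -[in LHS]sX mxE.
  have [<-|ij] := eqVneq i j; first by rewrite /cut; case: fX => _ _ -> *; ring.
  rewrite /cut mxE; move: ij; rewrite -val_eqE => /negbTE /= ->.
  case: i j => [[|[|[|[|[|[|//]]]]]] ?] [[|[|[|[|[|[|//]]]]]] ?] /=; ring.
have -> : \sum_i \sum_j triangles_lengths R i j * X i j
   = \sum_i \sum_j X i j + \sum_i \sum_j cut i j + \sum_i \sum_j cut j i.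
  rewrite -!big_split; apply: eq_bigr => i _; rewrite -!big_split.
  exact: eq_bigr.
rewrite [\sum_i \sum_j cut j i]exchange_big /=.
have -> : \sum_i \sum_j X i j = 12.
  rewrite (eq_bigr (fun=> 2)) => [|i _]; last exact: LP_feasible_row.
  by rewrite sumr_const card_ord; ring.
lra.
Qed.

Lemma SDP_lt_LP_triangles (R : realType) :
  (SDP (triangles_lengths R) < LP (triangles_lengths R))%E.
Proof.
apply: le_lt_trans (SDP_triangles_le R) _.
by apply: lt_le_trans (LP_triangles_ge R); rewrite lte_fin; lra.
Qed.

(** * Weighted sums of entries and orbit averages *)

(** Weights are indexed by natural numbers so that they can be evaluated on
    concrete indices. *)
Definition weigh (R : realType) n (W : nat -> nat -> R) (M : 'M[R]_n) : R :=
  \sum_(i < n) \sum_(j < n) W i j * M i j.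

Lemma weighD (R : realType) n W (M N : 'M[R]_n) :
  weigh W (M + N) = weigh W M + weigh W N.
Proof.
rewrite /weigh -big_split; apply: eq_bigr => i _; rewrite -big_split.
by apply: eq_bigr => j _; rewrite mxE mulrDr.
Qed.

Lemma weigh_sumZ (R : realType) n W m (c : 'I_m -> R) (X : 'I_m -> 'M[R]_n) :
  weigh W (\sum_k c k *: X k) = \sum_k c k * weigh W (X k).
Proof.
elim/big_rec2: _ => [|k y M _ <-].
  by rewrite /weigh big1 // => i _; rewrite big1 // => j _; rewrite mxE mulr0.
rewrite weighD; congr (_ + _); rewrite /weigh mulr_sumr; apply: eq_bigr => i _.
by rewrite mulr_sumr; apply: eq_bigr => j _; rewrite mxE mulrCA.
Qed.

Definition orbit_mean (R : realType) n (O : rel nat) (M : 'M[R]_n) : R :=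
  weigh (fun i j => if O i j then 1 else 0) M
    / weigh (fun i j => if O i j then 1 else 0) (ones_mx : 'M[R]_n).

Lemma quad_weighE (R : realType) n (M : 'M[R]_n) (v : nat -> R) :
  ((\col_i v i)^T *m M *m \col_i v i) 0 0 = weigh (fun i j => v i * v j) M.
Proof.
rewrite quad_formE; apply: eq_bigr => i _; apply: eq_bigr => j _.
by rewrite !mxE mulrAC.
Qed.

Lemma weigh_weightD (R : realType) n V W (M : 'M[R]_n) :
  weigh (fun i j => V i j + W i j) M = weigh V M + weigh W M.
Proof.
rewrite /weigh -big_split; apply: eq_bigr => i _; rewrite -big_split.
by apply: eq_bigr => j _; rewrite mulrDl.
Qed.

Lemma weigh_weightZ (R : realType) n c W (M : 'M[R]_n) :
  weigh (fun i j => c * W i j) M = c * weigh W M.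
Proof.
rewrite /weigh mulr_sumr; apply: eq_bigr => i _; rewrite mulr_sumr.
by apply: eq_bigr => j _; rewrite mulrA.
Qed.

Lemma eq_weigh (R : realType) n V W (M : 'M[R]_n) :
  (forall i j, (i < n)%N -> (j < n)%N -> V i j = W i j) ->
  weigh V M = weigh W M.
Proof.
by move=> VW; apply: eq_bigr => i _; apply: eq_bigr => j _; rewrite VW.
Qed.

(** Lists instead of a big operator, so that the count evaluates. *)
Definition pair_count (n : nat) (O : rel nat) : nat :=
  sumn [seq count (O i) (iota 0 n) | i <- iota 0 n].

Lemma weigh_orbit (R : realType) n (O : rel nat) (M : 'M[R]_n) :
  (0 < pair_count n O)%N ->
  weigh (fun i j => if O i j then 1 else 0) M
    = (pair_count n O)%:R * orbit_mean O M.
Proof.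
move=> O0; rewrite /orbit_mean mulrC.
suff -> : weigh (fun i j => if O i j then 1 else 0) (ones_mx : 'M[R]_n)
    = (pair_count n O)%:R.
  by rewrite mulfVK // pnatr_eq0 -lt0n.
have iotaE : iota 0 n = index_iota 0 n by rewrite /index_iota subn0.
rewrite /pair_count sumnE big_map iotaE big_mkord natr_sum.
apply: eq_bigr => i _; rewrite -sum1_count [in RHS]big_mkcond.
rewrite big_mkord natr_sum.
by apply: eq_bigr => j _; rewrite mxE mulr1; case: ifP.
Qed.

Lemma psd_weigh_ge0 (R : realType) n (M : 'M[R]_n) (v : nat -> R) :
  psd_mx M -> 0 <= weigh (fun i j => v i * v j) M.
Proof. by move=> [_ pM]; rewrite -quad_weighE. Qed.

(** Row sums enter through a symmetric weight, so that it is constant on orbits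
    when [f] distinguishes only middles from ends. *)
Lemma row_weigh (R : realType) n (M : 'M[R]_n) (r : R) (f : nat -> R) :
  symmetric_mx M -> (forall i, \sum_j M i j = r) ->
  weigh (fun i j => f i + f j) M = 2 * r * \sum_(i < n) f i.
Proof.
move=> sM rM; rewrite weigh_weightD.
have rowE : weigh (fun i _ => f i) M = r * \sum_(i < n) f i.
  by rewrite mulr_sumr; apply: eq_bigr => i _; rewrite -mulr_sumr rM mulrC.
have -> : weigh (fun _ j => f j) M = weigh (fun i _ => f i) M.
  rewrite {1}/weigh exchange_big; apply: eq_bigr => i _; apply: eq_bigr => j _.
  by rewrite -{1}sM mxE.
by rewrite rowE; ring.
Qed.

(** The matrix of the semidefinite constraint of frequency [f], with the true
    index of the frequency and of the distance [k.+1]. *)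
Definition freq_mx (R : realType) n (X : 'I_(n./2) -> 'M[R]_n) (f : nat) :
    'M[R]_n :=
  1%:M + \sum_(k < n./2) turn_cos R n (f * k.+1) *: X k.

Lemma psd_freq_mx (R : realType) n (X : 'I_(n./2) -> 'M[R]_n) f :
  SDP_feasible X -> (0 < f <= n./2)%N -> psd_mx (freq_mx X f).
Proof.
case: f => // f [_ _ _ pX] /= fn; have := pX (Ordinal fn).
congr psd_mx; congr (_ + _); apply: eq_bigr => k _; congr (_ *: _).
by rewrite /turn_cos natrM !mulrA.
Qed.

(** The diagonal entries are nonnegative and add up to those of [J - I]. *)
Lemma SDP_feasible_diag (R : realType) n (X : 'I_(n./2) -> 'M[R]_n) k i :
  SDP_feasible X -> X k i i = 0.
Proof.
move=> [_ nX sX _].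
move/matrixP: sX => /(_ i i)/eqP.
rewrite summxE !mxE eqxx subrr psumr_eq0 => [/allP /(_ k)|m _].
  by rewrite mem_index_enum => /(_ isT)/eqP.
by have := nX m i i; rewrite mxE.
Qed.

Lemma freq_mx_diag (R : realType) n (X : 'I_(n./2) -> 'M[R]_n) f i :
  SDP_feasible X -> freq_mx X f i i = 1.
Proof.
move=> fX; rewrite !mxE eqxx summxE big1 ?addr0 // => k _.
by rewrite mxE SDP_feasible_diag // mulr0.
Qed.

(** Irreflexivity makes the identity matrix invisible to the average, and
    nonemptiness makes the average of the all-ones matrix equal to 1. *)
Definition orbit_of (n : nat) (O : rel nat) : Prop :=
  irreflexive O /\ exists i j : 'I_n, O i j.

Lemma orbit_mean_linear (R : realType) n O c (M N : 'M[R]_n) :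
  orbit_mean O (M + c *: N) = orbit_mean O M + c * orbit_mean O N.
Proof.
rewrite /orbit_mean weighD mulrDl mulrA; congr (_ + _ * _).
rewrite /weigh mulr_sumr; apply: eq_bigr => i _; rewrite mulr_sumr.
by apply: eq_bigr => j _; rewrite mxE mulrCA.
Qed.

Lemma orbit_mean_id (R : realType) n O : irreflexive O ->
  orbit_mean O (1%:M : 'M[R]_n) = 0.
Proof.
move=> O0; rewrite /orbit_mean {1}/weigh big1 ?mul0r // => i _.
rewrite big1 // => j _; rewrite mxE; case: eqP => [<-|_].
  by rewrite O0 mul0r.
by rewrite mulr0.
Qed.

Lemma orbit_mean_ones (R : realType) n O : orbit_of n O ->
  orbit_mean O (ones_mx : 'M[R]_n) = 1.
Proof.
move=> [_ [i [j Oij]]]; apply: divff; apply: lt0r_neq0.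
have ge0 (k l : 'I_n) : 0 <= (if O k l then 1 else 0) * (ones_mx : 'M[R]_n) k l.
  by rewrite mxE mulr1; case: ifP.
rewrite /weigh (bigD1 i) //= (bigD1 j) //= Oij mxE mulr1.
rewrite ltr_wpDr ?sumr_ge0 // => [k _|]; first by rewrite sumr_ge0.
by rewrite ltr_wpDr ?sumr_ge0.
Qed.

Lemma orbit_mean_ge0 (R : realType) n O (M : 'M[R]_n) :
  mx_le 0 M -> 0 <= orbit_mean O M.
Proof.
move=> M0; rewrite /orbit_mean divr_ge0 // /weigh.
  apply: sumr_ge0 => i _; apply: sumr_ge0 => j _.
  by rewrite mulr_ge0 //; [case: ifP | have := M0 i j; rewrite mxE].
apply: sumr_ge0 => i _; apply: sumr_ge0 => j _.
by rewrite mxE mulr1; case: ifP.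
Qed.

Lemma orbit_mean_sumZ (R : realType) n O m (c : 'I_m -> R)
    (X : 'I_m -> 'M[R]_n) :
  orbit_mean O (\sum_k c k *: X k) = \sum_k c k * orbit_mean O (X k).
Proof.
rewrite /orbit_mean weigh_sumZ mulr_suml.
by apply: eq_bigr => k _; rewrite mulrA.
Qed.

Lemma orbit_mean_freq (R : realType) n O (X : 'I_(n./2) -> 'M[R]_n) f :
  irreflexive O ->
  orbit_mean O (freq_mx X f)
    = \sum_(k < n./2) turn_cos R n (f * k.+1) * orbit_mean O (X k).
Proof.
move=> O0; rewrite -orbit_mean_sumZ.
have := orbit_mean_linear O 1 1%:M (freq_mx X f - 1%:M).
rewrite scale1r subrKC orbit_mean_id // add0r mul1r => ->.
by rewrite /freq_mx addrC addKr.
Qed.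

(** As the matrices sum to [J - I], the orbit averages of a feasible point form
    a probability distribution on distances. *)
Lemma orbit_mean_total (R : realType) n O (X : 'I_(n./2) -> 'M[R]_n) :
  orbit_of n O -> SDP_feasible X -> \sum_k orbit_mean O (X k) = 1.
Proof.
move=> oO [_ _ sX _]; have [O0 _] := oO.
transitivity (\sum_k 1 * orbit_mean O (X k)).
  by apply: eq_bigr => k _; rewrite mul1r.
rewrite -orbit_mean_sumZ (eq_bigr X) => [|k _]; last by rewrite scale1r.
rewrite sX -scaleN1r orbit_mean_linear orbit_mean_ones // orbit_mean_id //.
by rewrite mulr0 addr0.
Qed.

(** A distribution with mass at least [1 - e] on one distance has all its
    cosine moments within [2 e] of those of that distance, since two cosines
    differ by at most 2. *)
Lemma freq_orbit_near (R : realType) n O (X : 'I_(n./2) -> 'M[R]_n) f k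
    (e : R) :
  orbit_of n O -> SDP_feasible X -> 1 - e <= orbit_mean O (X k) ->
  `|orbit_mean O (freq_mx X f) - turn_cos R n (f * k.+1)| <= 2 * e.
Proof.
move=> oO fX ke; have [O0 _] := oO; have [_ nX _ _] := fX.
have tX := orbit_mean_total oO fX.
have x0 m : 0 <= orbit_mean O (X m) by exact: orbit_mean_ge0.
rewrite orbit_mean_freq // -[X in _ - X]mulr1 -[X in _ - _ * X]tX mulr_sumr.
rewrite -sumrB (bigD1 k) //= subrr add0r.
have rest : \sum_(m < n./2 | m != k) orbit_mean O (X m) <= e.
  by move: tX ke; rewrite (bigD1 k) //=; lra.
apply: le_trans (ler_norm_sum _ _ _) _.
apply: le_trans (ler_wpM2l _ rest) => //.
rewrite mulr_sumr; apply: ler_sum => m _.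
rewrite -mulrBl normrM (ger0_norm (x0 m)) ler_wpM2r //.
apply: le_trans (ler_normB _ _) _.
have := @cos_max R (2 * pi * (f * m.+1)%:R / n%:R).
have := @cos_max R (2 * pi * (f * k.+1)%:R / n%:R).
rewrite -!/(turn_cos _ _ _); lra.
Qed.

(** * Three paths between two triangles: orbits of pairs *)

(** The vertices of the graph are numbered so that [i %% 3] is the path of [i]
    and [i %/ 3] its position on the path: 0 and 2 for the ends, 1 for the
    middle. Two ends are opposite when they lie in different caps. The six
    relations from [path_edge] to [cross_cap] are the orbits of pairs of
    distinct vertices under the symmetries of the graph. *)
Definition same_path : rel nat := fun i j => (i %% 3 == j %% 3)%N.
Definition mid : pred nat := fun i => (i %/ 3 == 1)%N.
Definition opposite : rel nat := fun i j => (i %/ 3 + j %/ 3 == 2)%N.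

Definition path_edge : rel nat := fun i j => same_path i j && (mid i != mid j).
Definition path_ends : rel nat :=
  fun i j => [&& same_path i j, ~~ mid i, ~~ mid j & opposite i j].
Definition mid_mid : rel nat := fun i j => [&& ~~ same_path i j, mid i & mid j].
Definition mid_end : rel nat := fun i j => ~~ same_path i j && (mid i != mid j).
Definition same_cap : rel nat :=
  fun i j => [&& ~~ same_path i j, ~~ mid i, ~~ mid j & ~~ opposite i j].
Definition cross_cap : rel nat :=
  fun i j => [&& ~~ same_path i j, ~~ mid i, ~~ mid j & opposite i j].

Lemma orbit_path_edge : orbit_of 9 path_edge.
Proof.
split=> [i|]; last by exists (inord 0), (inord 3); rewrite !inordK.
by rewrite /path_edge eqxx andbF.
Qed.

Lemma orbit_path_ends : orbit_of 9 path_ends.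
Proof.
split=> [i|]; last by exists (inord 0), (inord 6); rewrite !inordK.
rewrite /path_ends /mid /opposite /same_path eqxx /=.
by case: (i %/ 3)%N => [|[|m]] //=; rewrite addnS.
Qed.

Lemma orbit_mid_mid : orbit_of 9 mid_mid.
Proof.
split=> [i|]; last by exists (inord 3), (inord 4); rewrite !inordK.
by rewrite /mid_mid /same_path eqxx.
Qed.

Lemma orbit_same_cap : orbit_of 9 same_cap.
Proof.
split=> [i|]; last by exists (inord 0), (inord 1); rewrite !inordK.
by rewrite /same_cap /same_path eqxx.
Qed.

Lemma orbit_cross_cap : orbit_of 9 cross_cap.
Proof.
split=> [i|]; last by exists (inord 0), (inord 7); rewrite !inordK.
by rewrite /cross_cap /same_path eqxx.
Qed.

(** Averaging over the symmetries without averaging matrices: for weights that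
    are constant on the orbits, the weighted sum of the entries depends only on
    the diagonal and on the six orbit averages.  The factors are the numbers of
    ordered pairs in the orbits. *)
Lemma weigh_orbits (R : realType) (M : 'M[R]_9) (d : R) (W : nat -> nat -> R)
    (gm ge gT gR gA gC gP gQ : R) :
  (forall i, M i i = d) ->
  (forall i j, (i < 9)%N -> (j < 9)%N ->
    W i j = if i == j then if mid i then gm else ge
            else if path_edge i j then gT else if path_ends i j then gR
            else if mid_mid i j then gA else if mid_end i j then gC
            else if same_cap i j then gP else gQ) ->
  weigh W M = d * (3 * gm + 6 * ge)
    + 12 * gT * orbit_mean path_edge M + 6 * gR * orbit_mean path_ends M
    + 6 * gA * orbit_mean mid_mid M + 24 * gC * orbit_mean mid_end M
    + 12 * gP * orbit_mean same_cap M + 12 * gQ * orbit_mean cross_cap M.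
Proof.
move=> dM WE; pose ind (O : rel nat) i j : R := if O i j then 1 else 0.
have nT : weigh (ind path_edge) M = 12 * orbit_mean path_edge M.
  exact: weigh_orbit.
have nR : weigh (ind path_ends) M = 6 * orbit_mean path_ends M.
  exact: weigh_orbit.
have nA : weigh (ind mid_mid) M = 6 * orbit_mean mid_mid M.
  exact: weigh_orbit.
have nC : weigh (ind mid_end) M = 24 * orbit_mean mid_end M.
  exact: weigh_orbit.
have nP : weigh (ind same_cap) M = 12 * orbit_mean same_cap M.
  exact: weigh_orbit.
have nQ : weigh (ind cross_cap) M = 12 * orbit_mean cross_cap M.
  exact: weigh_orbit.
pose dg i j : R := if i == j then if mid i then gm else ge else 0.
have nd : weigh dg M = d * (3 * gm + 6 * ge).
  transitivity (\sum_(i < 9) (if mid i then gm else ge) * d).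
    apply: eq_bigr => i _; rewrite (bigD1 i) //= /dg eqxx dM big1 ?addr0 //.
    by move=> j ji; rewrite eq_sym -val_eqE in ji; rewrite (negbTE ji) mul0r.
  by rewrite !big_ord_recl big_ord0 /=; ring.
transitivity (weigh (fun i j => dg i j + gT * ind path_edge i j
    + gR * ind path_ends i j + gA * ind mid_mid i j + gC * ind mid_end i j
    + gP * ind same_cap i j + gQ * ind cross_cap i j) M); last first.
  by rewrite !weigh_weightD !weigh_weightZ nd nT nR nA nC nP nQ; ring.
apply: eq_weigh => i j i9 j9; rewrite WE // /dg /ind; move: i9 j9.
by do 9?[case: i => [|i]]; do 9?[case: j => [|j]] => //= _ _; ring.
Qed.

(** * Three paths between two triangles: the linear bound *)

Definition theta_lengths (R : realType) : 'M[R]_9 :=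
  \matrix_(i, j) if path_edge i j || same_cap i j then 1 else 2.

(** Twice the weights of the fractional solution, to make the cut constraints
    inequalities between integers. *)
Definition theta_weight (i j : nat) : nat :=
  if path_edge i j then 2 else if same_cap i j then 1 else 0.

Definition theta_point (R : realType) : 'M[R]_9 :=
  \matrix_(i, j) ((theta_weight i j)%:R / 2).

(** The mask [s] marks one side of the cut; lists instead of big operators, so
    that the weight evaluates. *)
Definition theta_cut (s : seq bool) : nat :=
  sumn [seq sumn [seq if nth false s i && ~~ nth false s j
                      then theta_weight i j else 0 | j <- iota 0 9]
       | i <- iota 0 9]%N.

(** A cut that splits both caps contains four cap edges, one that splits a
    single cap contains two cap edges and a path edge, and one that splits no
    cap contains two path edges. *)
Lemma theta_cut_ge4 (b0 b1 b2 b3 b4 b5 b6 b7 b8 : bool) :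
  let s := [:: b0; b1; b2; b3; b4; b5; b6; b7; b8] in
  has id s -> ~~ all id s -> (4 <= theta_cut s)%N.
Proof.
by move: b0 b1 b2 b3 b4 b5 b6 b7 b8; do 9![case]; vm_compute.
Qed.

Lemma LP_feasible_theta (R : realType) : LP_feasible (theta_point R).
Proof.
split.
- apply/matrixP => i j; rewrite !mxE; congr (_%:R / 2); move: i j.
  by do 2![case=> [[|[|[|[|[|[|[|[|[|//]]]]]]]]] ?]].
- apply/matrixP => i j; rewrite !mxE mulr1 !big_ord_recl big_ord0 !mxE.
  case: i => [[|[|[|[|[|[|[|[|[|//]]]]]]]]] ?];
    by rewrite /theta_weight /=; lra.
- by case=> [[|[|[|[|[|[|[|[|[|//]]]]]]]]] ?]; rewrite mxE /= mul0r.
- split=> i j; rewrite !mxE; first by rewrite divr_ge0 ?ler0n.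
  by rewrite /theta_weight; do 2?[case: ifP => _]; lra.
- move=> S S0 ST; set s := [seq (inord i \in S : bool) | i <- iota 0 9].
  have sE (i : 'I_9) : nth false s i = (i \in S).
    by rewrite (nth_map 0%N) ?size_iota // nth_iota // inord_val.
  have -> : \sum_(i in S) \sum_(j | j \notin S) theta_point R i j
      = (theta_cut s)%:R / 2.
    rewrite /theta_cut sumnE big_map -[iota 0 9]/(index_iota 0 9) big_mkord.
    rewrite natr_sum mulr_suml big_mkcond; apply: eq_bigr => i _.
    rewrite sumnE big_map big_mkord natr_sum mulr_suml sE.
    case: ifP => iS; last first.
      by rewrite big1 // => j _; rewrite mul0r.
    rewrite big_mkcond; apply: eq_bigr => j _; rewrite sE mxE.
    by case: (j \in S); rewrite /= ?mul0r.
  rewrite ler_pdivlMr // -natrM ler_nat; apply: theta_cut_ge4.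
    have /set0Pn[i iS] := S0; apply/hasP; exists (i \in S) => //.
    by rewrite -(sE i); exact: (mem_nth false (ltn_ord i : (i < size s)%N)).
  have /properP[_ [i _ iS]] := ST; apply/allPn; exists (i \in S) => //.
  by rewrite -(sE i); exact: (mem_nth false (ltn_ord i : (i < size s)%N)).
Qed.

Lemma tsp_lengths_theta (R : realType) : tsp_lengths (theta_lengths R).
Proof.
split=> [|i j _]; last by rewrite mxE; case: ifP => _; lra.
apply/matrixP => i j; rewrite !mxE; move: i j.
by do 2![case=> [[|[|[|[|[|[|[|[|[|//]]]]]]]]] ?]].
Qed.

Lemma LP_theta_le (R : realType) : (LP (theta_lengths R) <= (9 : R)%:E)%E.
Proof.
apply: ereal_inf_lbound; exists (theta_point R); first exact: LP_feasible_theta.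
have fX := LP_feasible_theta R; have [sX _ _ _ _] := fX.
congr EFin; rewrite tour_costE //.
transitivity (2^-1 * \sum_(i < 9) \sum_(j < 9) theta_point R i j).
  congr (_ * _); apply: eq_bigr => i _; apply: eq_bigr => j _; rewrite !mxE.
  by rewrite /theta_weight; case: path_edge; case: same_cap => /=; lra.
rewrite (eq_bigr (fun=> 2)) => [|i _]; last exact: LP_feasible_row.
by rewrite sumr_const card_ord; field.
Qed.

(** * Test vectors and row sums in terms of orbit averages *)

(** The second difference [x_0 - 2 c x_1 + x_2] along path [a]; it vanishes on
    vectors that rotate by a constant angle of cosine [c]. *)
Definition path_defect (R : realType) (c : R) (a i : nat) : R :=
  if (i %% 3 == a)%N then (if mid i then - 2 * c else 1) else 0.

(** Three times this quantity is the sum of the squared norms of the path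
    defects. *)
Lemma path_form_ge0 (R : realType) (M : 'M[R]_9) (c : R) :
  psd_mx M -> (forall i, M i i = 1) ->
  0 <= 2 + 2 * orbit_mean path_ends M + 4 * c ^+ 2
       - 8 * c * orbit_mean path_edge M.
Proof.
move=> pM dM; pose w := path_defect c.
have := addr_ge0 (addr_ge0 (psd_weigh_ge0 (w 0%N) pM)
  (psd_weigh_ge0 (w 1%N) pM)) (psd_weigh_ge0 (w 2%N) pM).
rewrite -!weigh_weightD.
rewrite (@weigh_orbits R M 1 _ (4 * c ^+ 2) 1 (- 2 * c) 1 0 0 0 0) //.
  by lra.
move=> i j i9 j9; rewrite /w /path_defect; move: i9 j9.
by do 9?[case: i => [|i]]; do 9?[case: j => [|j]] => //= _ _; ring.
Qed.

(** Six times this quantity is the sum of the squared norms of the pairwise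
    differences of the path defects; its positivity bounds the norm of the sum
    of the defects by their individual norms. *)
Lemma path_pair_form_ge0 (R : realType) (M : 'M[R]_9) (c : R) :
  psd_mx M -> (forall i, M i i = 1) ->
  0 <= 2 + 2 * orbit_mean path_ends M + 4 * c ^+ 2
       - 8 * c * orbit_mean path_edge M - 2 * orbit_mean same_cap M
       - 2 * orbit_mean cross_cap M + 8 * c * orbit_mean mid_end M
       - 4 * c ^+ 2 * orbit_mean mid_mid M.
Proof.
move=> pM dM; pose w a b i := path_defect c a i - path_defect c b i.
have := addr_ge0 (addr_ge0 (psd_weigh_ge0 (w 0 1)%N pM)
  (psd_weigh_ge0 (w 0 2)%N pM)) (psd_weigh_ge0 (w 1 2)%N pM).
rewrite -!weigh_weightD.
rewrite (@weigh_orbits R M 1 _ (8 * c ^+ 2) 2 (- 4 * c) 2 (- 4 * c ^+ 2)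
  (2 * c) (-1) (-1)) //.
  by lra.
move=> i j i9 j9; rewrite /w /path_defect; move: i9 j9.
by do 9?[case: i => [|i]]; do 9?[case: j => [|j]] => //= _ _; ring.
Qed.

(** Up to a factor 6, this is the value of the form at the vector that is 1 on
    one cap, -1 on the other and 0 on the middles. *)
Lemma orientation_form_ge0 (R : realType) (M : 'M[R]_9) :
  psd_mx M -> (forall i, M i i = 1) ->
  0 <= 1 - orbit_mean path_ends M + 2 * orbit_mean same_cap M
       - 2 * orbit_mean cross_cap M.
Proof.
move=> pM dM.
have := psd_weigh_ge0
  (fun i => if mid i then 0 else if (i < 3)%N then 1 else -1) pM.
rewrite (@weigh_orbits R M 1 _ 0 1 0 (-1) 0 0 1 (-1)) //.
  by lra.
move=> i j i9 j9; move: i9 j9.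
by do 9?[case: i => [|i]]; do 9?[case: j => [|j]] => //= _ _; ring.
Qed.

Lemma mid_row_sum (R : realType) (M : 'M[R]_9) (d r : R) :
  symmetric_mx M -> (forall i, M i i = d) -> (forall i, \sum_j M i j = r) ->
  d + 2 * orbit_mean path_edge M + 2 * orbit_mean mid_mid M
    + 4 * orbit_mean mid_end M = r.
Proof.
move=> sM dM rM.
have := @row_weigh R 9 M r (fun i => if mid i then 1 else 0) sM rM.
rewrite !big_ord_recl big_ord0 /= (@weigh_orbits R M d _ 2 0 1 0 2 1 0 0) //.
  by lra.
move=> i j i9 j9; move: i9 j9.
by do 9?[case: i => [|i]]; do 9?[case: j => [|j]] => //= _ _; ring.
Qed.

Lemma end_row_sum (R : realType) (M : 'M[R]_9) (d r : R) :
  symmetric_mx M -> (forall i, M i i = d) -> (forall i, \sum_j M i j = r) ->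
  d + orbit_mean path_edge M + orbit_mean path_ends M + 2 * orbit_mean mid_end M
    + 2 * orbit_mean same_cap M + 2 * orbit_mean cross_cap M = r.
Proof.
move=> sM dM rM.
have := @row_weigh R 9 M r (fun i => if mid i then 0 else 1) sM rM.
rewrite !big_ord_recl big_ord0 /= (@weigh_orbits R M d _ 0 2 1 2 0 1 2 2) //.
  by lra.
move=> i j i9 j9; move: i9 j9.
by do 9?[case: i => [|i]]; do 9?[case: j => [|j]] => //= _ _; ring.
Qed.

(** All entries of [X] sum to 18, so the cost is 9 plus half the weight of the
    pairs that are not edges of the graph. *)
Lemma theta_costE (R : realType) (X : 'M[R]_9) :
  symmetric_mx X -> (forall i, X i i = 0) -> (forall i, \sum_j X i j = 2) ->
  tour_cost (theta_lengths R) X = 9 + 3 * orbit_mean path_ends X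
    + 3 * orbit_mean mid_mid X + 12 * orbit_mean mid_end X
    + 6 * orbit_mean cross_cap X.
Proof.
move=> sX dX rX; rewrite tour_costE //.
have := mid_row_sum sX dX rX; have := end_row_sum sX dX rX.
have -> : \sum_i \sum_j theta_lengths R i j * X i j
    = weigh (fun i j => if path_edge i j || same_cap i j then 1 else 2) X.
  by apply: eq_bigr => i _; apply: eq_bigr => j _; rewrite mxE.
rewrite (@weigh_orbits R X 0 _ 2 2 1 2 2 2 1 2) //.
  by lra.
move=> i j i9 j9; move: i9 j9.
by do 9?[case: i => [|i]]; do 9?[case: j => [|j]] => //=.
Qed.

(** * Constraint matrices on nine cities *)

Lemma row_linear (R : realType) n (i : 'I_n) c (M N : 'M[R]_n) :
  \sum_j (M + c *: N) i j = \sum_j M i j + c * \sum_j N i j.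
Proof.
by rewrite mulr_sumr -big_split; apply: eq_bigr => j _; rewrite !mxE.
Qed.

(** The table of the cosines of [f * k] ninths of a turn.  It is stated for an
    arbitrary linear functional because it serves for orbit averages, for row
    sums and for the sum of all entries. *)
Lemma freq9E (R : realType) (X : 'I_4 -> 'M[R]_9) (L : 'M[R]_9 -> R)
    (a := turn_cos R 9 1) (b := turn_cos R 9 2) (d := turn_cos R 9 4)
    (x1 := L (X (inord 0))) (x2 := L (X (inord 1)))
    (x3 := L (X (inord 2))) (x4 := L (X (inord 3))) :
  (forall c M N, L (M + c *: N) = L M + c * L N) ->
  [/\ L (@freq_mx R 9 X 1) = L 1%:M
        + (a * x1 + b * x2 + (- 1 / 2) * x3 + d * x4),
      L (@freq_mx R 9 X 2) = L 1%:M
        + (b * x1 + d * x2 + (- 1 / 2) * x3 + a * x4),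
      L (@freq_mx R 9 X 3) = L 1%:M
        + ((- 1 / 2) * x1 + (- 1 / 2) * x2 + x3 + (- 1 / 2) * x4) &
      L (@freq_mx R 9 X 4) = L 1%:M
        + (d * x1 + a * x2 + (- 1 / 2) * x3 + b * x4)].
Proof.
move=> linL; have [c3 _ _ _] := turn_cos9 R.
have c6 : turn_cos R 9 6 = - 1 / 2 by rewrite (@turn_cosB R 9 3).
have c8 : turn_cos R 9 8 = a by rewrite (@turn_cosB R 9 1).
have c9 : turn_cos R 9 9 = 1 by rewrite (@turn_cosD R 9 0) ?turn_cos0.
have c12 : turn_cos R 9 12 = - 1 / 2 by rewrite (@turn_cosD R 9 3).
have c16 : turn_cos R 9 16 = b.
  by rewrite (@turn_cosD R 9 7) // (@turn_cosB R 9 2).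
have expand f : L (@freq_mx R 9 X f) = L 1%:M + (turn_cos R 9 (f * 1) * x1
    + turn_cos R 9 (f * 2) * x2 + turn_cos R 9 (f * 3) * x3
    + turn_cos R 9 (f * 4) * x4).
  have -> : @freq_mx R 9 X f = 1%:M + turn_cos R 9 (f * 1) *: X (inord 0)
      + turn_cos R 9 (f * 2) *: X (inord 1)
      + turn_cos R 9 (f * 3) *: X (inord 2)
      + turn_cos R 9 (f * 4) *: X (inord 3) :> 'M_9.
    rewrite /freq_mx; transitivity (1%:M +
      \sum_(k < 4) turn_cos R 9 (f * k.+1) *: X (inord k) : 'M[R]_9).
      by congr (_ + _); apply: eq_bigr => k _; rewrite inord_val.
    by rewrite !big_ord_recl big_ord0 addr0 !addrA.
  by rewrite !linL -/x1 -/x2 -/x3 -/x4 !addrA.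
by split; rewrite expand ?c3 ?c6 ?c8 ?c9 ?c12 ?c16 ?mul1r.
Qed.

Lemma SDP9_total (R : realType) (X : 'I_4 -> 'M[R]_9) (L : 'M[R]_9 -> R)
    (x1 := L (X (inord 0))) (x2 := L (X (inord 1)))
    (x3 := L (X (inord 2))) (x4 := L (X (inord 3))) :
  (forall c M N, L (M + c *: N) = L M + c * L N) ->
  @SDP_feasible R 9 X -> x1 + x2 + x3 + x4 = L ones_mx - L 1%:M.
Proof.
move=> linL [_ _ sX _].
have <- : X (inord 0) + 1 *: X (inord 1) + 1 *: X (inord 2) + 1 *: X (inord 3)
    + 1 *: 1%:M = ones_mx.
  apply/eqP; rewrite !scale1r eq_sym -subr_eq; apply/eqP; symmetry.
  transitivity (\sum_(k < 4) X (inord k)).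
    by rewrite !big_ord_recl big_ord0 addr0 !addrA.
  by rewrite -sX; apply: eq_bigr => k _; rewrite inord_val.
by rewrite !linL; rewrite -/x1 -/x2 -/x3 -/x4; ring.
Qed.

(** At the all-ones vector the values [t_f] of the four constraint matrices
    are nonnegative and satisfy [t_1 + t_2 + t_3 + t_4 = 0], because the
    cosines of a fixed nonzero distance sum to -1/2. So the all-ones vector is
    in each kernel. The resulting linear system for the row sums of the [X k]
    is invertible. *)
Lemma SDP9_rows (R : realType) (X : 'I_4 -> 'M[R]_9) :
  @SDP_feasible R 9 X ->
  (forall k i, \sum_j X k i j = 2) /\
  (forall f i, (0 < f <= 4)%N -> \sum_j (@freq_mx R 9 X f) i j = 0).
Proof.
move=> fX; have [_ bE dE ab] := turn_cos9 R.
pose tot (M : 'M[R]_9) := \sum_i \sum_j M i j.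
have totL c M N : tot (M + c *: N) = tot M + c * tot N.
  rewrite /tot mulr_sumr -big_split.
  by apply: eq_bigr => i _; apply: row_linear.
pose e : 'cV[R]_9 := ones_mx.
have quadE (M : 'M[R]_9) : (e^T *m M *m e) 0 0 = tot M.
  rewrite quad_formE; apply: eq_bigr => i _; apply: eq_bigr => j _.
  by rewrite !mxE mul1r mulr1.
have tot1 : tot 1%:M = 9.
  rewrite /tot (eq_bigr (fun=> 1)) => [|i _].
    by rewrite sumr_const card_ord.
  by rewrite (bigD1 i) //= mxE eqxx big1 ?addr0 // => j /negbTE;
     rewrite mxE eq_sym => ->.
have totJ : tot ones_mx = 81.
  rewrite /tot (eq_bigr (fun=> 9)) => [|i _].
    by rewrite sumr_const card_ord; ring.
  by rewrite (eq_bigr (fun=> 1)) => [|j _]; rewrite ?mxE // sumr_const card_ord.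
have pos f : (0 < f <= 4)%N -> 0 <= tot (@freq_mx R 9 X f).
  by move=> f4; rewrite -quadE; have [_] := psd_freq_mx fX f4; apply.
have tot0 f : (0 < f <= 4)%N -> tot (@freq_mx R 9 X f) = 0.
  have := SDP9_total totL fX; rewrite tot1 totJ.
  have [] := freq9E X totL; rewrite tot1 dE.
  move: (pos 1%N isT) (pos 2%N isT) (pos 3%N isT) (pos 4%N isT).
  case: f => [|[|[|[|[|//]]]]] // + + + + e1 e2 e3 e4 + _;
    rewrite e1 e2 e3 e4; clear; lra.
have row0 f i : (0 < f <= 4)%N -> \sum_j (@freq_mx R 9 X f) i j = 0.
  move=> f4; have := psd_freq_mx fX f4 => pf.
  transitivity ((@freq_mx R 9 X f *m e) i 0).
    by rewrite mxE; apply: eq_bigr => j _; rewrite [e _ _]mxE mulr1.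
  have -> : @freq_mx R 9 X f *m e = 0 by apply: psd_null; rewrite ?quadE ?tot0.
  by rewrite mxE.
split=> // k i.
have row1 : \sum_j (1%:M : 'M[R]_9) i j = 1.
  by rewrite (bigD1 i) //= mxE eqxx big1 ?addr0 // => j /negbTE;
     rewrite mxE eq_sym => ->.
have rowJ : \sum_j (ones_mx : 'M[R]_9) i j = 9.
  by rewrite (eq_bigr (fun=> 1)) => [|j _]; rewrite ?mxE // sumr_const card_ord.
have := SDP9_total (row_linear i) fX; rewrite row1 rowJ.
have [] := freq9E X (row_linear i); rewrite row1 dE !row0 //.
rewrite -[k]inord_val; case: k => k /= k4.
have -> : \sum_j X (inord k) i j = if k == 0%N then \sum_j X (inord 0) i j
   else if k == 1%N then \sum_j X (inord 1) i j
   else if k == 2%N then \sum_j X (inord 2) i j else \sum_j X (inord 3) i j.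
  by move: k k4; do 4![case=> //].
move: (turn_cos R 9 1) (turn_cos R 9 2) bE ab => a b bE /andP[la ua].
move: (\sum_j X (inord 0) i j) (\sum_j X (inord 1) i j) (\sum_j X (inord 2) i j)
  (\sum_j X (inord 3) i j) => r1 r2 r3 r4 e1 e2 e3 e4 eX.
have r3E : r3 = 2 by lra.
have r4E : r4 = 6 - r1 - r2 by lra.
have q1 : (2 * a + b) * (r1 - 2) + (a + 2 * b) * (r2 - 2) = 0.
  by move: e1; rewrite r3E r4E; clear; lra.
have q2 : (b - a) * (r1 - 2) - (2 * a + b) * (r2 - 2) = 0.
  by move: e2; rewrite r3E r4E; clear; lra.
(* The determinant of the system [q1], [q2] is nonzero. *)
have det : 0 < 3 * (a ^+ 2 + a * b + b ^+ 2) by rewrite bE; nra.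
have z1 : 3 * (a ^+ 2 + a * b + b ^+ 2) * (r1 - 2) = 0.
  transitivity ((2 * a + b) * ((2 * a + b) * (r1 - 2) + (a + 2 * b) * (r2 - 2))
    + (a + 2 * b) * ((b - a) * (r1 - 2) - (2 * a + b) * (r2 - 2))); first ring.
  by rewrite q1 q2; ring.
have z2 : 3 * (a ^+ 2 + a * b + b ^+ 2) * (r2 - 2) = 0.
  transitivity ((b - a) * ((2 * a + b) * (r1 - 2) + (a + 2 * b) * (r2 - 2))
    - (2 * a + b) * ((b - a) * (r1 - 2) - (2 * a + b) * (r2 - 2))); first ring.
  by rewrite q1 q2; ring.
have r1E : r1 = 2.
  by move/eqP: z1; rewrite mulf_eq0 gt_eqF //= subr_eq0 => /eqP.
have r2E : r2 = 2.
  by move/eqP: z2; rewrite mulf_eq0 gt_eqF //= subr_eq0 => /eqP.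
by rewrite r4E r3E r1E r2E; do 3?[case: ifP => _] => //; ring.
Qed.

(** * The distances forced by a small cost *)

(** With [T] close to [a], the inequality says that the inner product of the
    ends of a path is at least about [2 a^2 - 1], the cosine [b] of distance
    2. Distance 1 is almost excluded by [R1 <= e], and the other distances
    have smaller cosines, so nearly all the mass sits at distance 2. *)
Lemma path_ends_step (R : realType) (a b d e T R1 R2 R3 R4 : R) :
  19 / 25 < a < 10 / 13 -> b = 2 * a ^+ 2 - 1 -> d = - a - b ->
  [/\ 0 <= R1, 0 <= R2, 0 <= R3 & 0 <= R4] -> R1 + R2 + R3 + R4 = 1 ->
  R1 <= e -> a - 2 * e <= T ->
  0 <= 2 + 2 * (a * R1 + b * R2 + (- 1 / 2) * R3 + d * R4) + 4 * a ^+ 2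
       - 8 * a * T ->
  1 - 12 * e <= R2.
Proof.
move=> /andP[la ua] bE dE [p1 p2 p3 p4] s1 r1 Tn form.
have e0 : 0 <= e by lra.
have aT : 0 <= a * (T - a + 2 * e).
  by rewrite mulr_ge0 //; [move: la|move: Tn]; clear; lra.
have a0 : 0 <= 10 / 13 - a by rewrite subr_ge0 ltW.
have ae : 0 <= (10 / 13 - a) * e by rewrite mulr_ge0.
have lb : 3 / 20 < b by move: la ua; rewrite bE; clear; nra.
have r4 : 0 <= (- 1 / 2 - d) * R4.
  by rewrite mulr_ge0 // dE; move: la lb; clear; lra.
have r1' : 0 <= (10 / 13 - a) * R1 by rewrite mulr_ge0.
have key : (b + 1 / 2) * (1 - R2) <= 15 / 2 * e.
  rewrite (_ : R3 = 1 - R1 - R2 - R4) in form; last lra.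
  lra.
have r2 : 0 <= (b - 3 / 20) * (1 - R2).
  rewrite mulr_ge0 //; first by rewrite subr_ge0 ltW.
  by move: s1 p1 p3 p4; clear; lra.
by move: key r2 e0; clear; lra.
Qed.

(** Here [T], [Rf], [A], [C], [P] and [Q] are the orbit averages of a
    constraint matrix with cosine [c]. Its rows sum to zero, so the sum of the
    path defects is [-(1 + 2 c)] times the sum of the middle vectors, while
    each defect is small. Without errors, [1 + 2 c <> 0] would give [A <=
    -1/2]. *)
Lemma mid_mid_step (R : realType) (c e T Rf A C P Q : R) :
  -1 <= c <= 1 -> c - 2 * e <= T <= c + 2 * e ->
  Rf <= 2 * c ^+ 2 - 1 + 24 * e ->
  1 + 2 * T + 2 * A + 4 * C = 0 -> 1 + T + Rf + 2 * C + 2 * P + 2 * Q = 0 ->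
  0 <= 2 + 2 * Rf + 4 * c ^+ 2 - 8 * c * T - 2 * P - 2 * Q
       + 8 * c * C - 4 * c ^+ 2 * A ->
  (1 + 2 * c) ^+ 2 * (A + 1 / 2) <= 96 * e.
Proof.
move=> /andP[lc uc] /andP[lT uT] Rn rowm rowe form.
have cT : - 2 * e <= c * (T - c) by nra.
have CE : C = - (1 + 2 * T + 2 * A) / 4 by lra.
have PE : P = - (1 + T + Rf + 2 * C + 2 * Q) / 2 by lra.
rewrite PE CE in form; lra.
Qed.

(** Here [P] and [Q] are the distributions of distances between ends of
    different paths, in the same cap and in opposite caps. The form of
    frequency 3 yields [Q3 - P3 <= 1/2] up to the errors. The masses at
    distance 2 being negligible and [P1 - Q1] about 1/2, the form of frequency
    4 needs [Q3 - P3] to be about [13/20]. *)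
Lemma orientation_step (R : realType)
    (a b d P1 P2 P3 P4 Q1 Q2 Q3 Q4 R3 R4 : R) :
  19 / 25 < a < 10 / 13 -> b = 2 * a ^+ 2 - 1 -> d = - a - b ->
  0 <= P2 -> 0 <= Q2 -> P2 + Q2 <= 1 / 100 -> 49 / 100 <= P1 - Q1 ->
  P1 + P2 + P3 + P4 = 1 -> Q1 + Q2 + Q3 + Q4 = 1 ->
  - 1 / 2 - 1 / 100 <= R3 -> a - 1 / 100 <= R4 ->
  0 <= 1 - R3 + 2 * ((- 1 / 2) * P1 + (- 1 / 2) * P2 + P3 + (- 1 / 2) * P4)
     - 2 * ((- 1 / 2) * Q1 + (- 1 / 2) * Q2 + Q3 + (- 1 / 2) * Q4) ->
  0 <= 1 - R4 + 2 * (d * P1 + a * P2 + (- 1 / 2) * P3 + b * P4)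
     - 2 * (d * Q1 + a * Q2 + (- 1 / 2) * Q3 + b * Q4) -> False.
Proof.
move=> /andP[la ua] bE dE p2 q2 pq2 pq1 sP sQ r3 r4 f3 f4.
have u3 : Q3 - P3 <= 51 / 100 by move: sP sQ r3 f3; clear; lra.
have lb : 3 / 20 < b by move: la ua; rewrite bE; clear; nra.
have ub : b < 1 / 5 by move: la ua; rewrite bE; clear; nra.
have [bd ba b0] : [/\ 0 <= b - d, 0 <= a - b & 0 <= b + 1 / 2].
  by move: la lb ub; rewrite dE; clear; split; lra.
have h1 : 0 <= (b - d) * (P1 - Q1 - 49 / 100).
  by rewrite mulr_ge0 // subr_ge0.
have h2 : 0 <= (a - b) * (1 / 100 - (P2 - Q2)).
  by rewrite mulr_ge0 //; move: pq2 q2; clear; lra.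
have h3 : 0 <= (b + 1 / 2) * (51 / 100 - (Q3 - P3)).
  by rewrite mulr_ge0 // subr_ge0.
have P4E : P4 = 1 - P1 - P2 - P3 by move: sP; clear; lra.
have Q4E : Q4 = 1 - Q1 - Q2 - Q3 by move: sQ; clear; lra.
move: f4 h1 h2 h3 r4 la ua lb ub; rewrite P4E Q4E dE; clear; lra.
Qed.

(** The divisions are possible because [1 + 2 c] vanishes at none of the three
    cosines, unlike at [-1/2], the cosine of frequency 3. *)
Lemma mid_mid_total_step (R : realType) (a b d e x y z : R) :
  19 / 25 < a < 10 / 13 -> b = 2 * a ^+ 2 - 1 -> d = - a - b -> 0 <= e ->
  (1 + 2 * a) ^+ 2 * x <= 96 * e -> (1 + 2 * b) ^+ 2 * y <= 96 * e ->
  (1 + 2 * d) ^+ 2 * z <= 96 * e -> x + y + z <= 217 * e.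
Proof.
move=> /andP[la ua] bE dE e0 hx hy hz.
have lb : 3 / 20 < b by move: la ua; rewrite bE; clear; nra.
have divide (m s u : R) : 0 < m -> m <= s ^+ 2 -> s ^+ 2 * u <= 96 * e ->
    u <= 96 * e / m.
  move=> m0 ms su; rewrite ler_pdivlMr //.
  have [u0|u0] := lerP 0 u; last by apply: le_trans (_ : 0 <= _); nra.
  by apply: le_trans su; rewrite mulrC ler_wpM2r.
have hx' : x <= 96 * e / 6 by apply: divide hx; nra.
have hy' : y <= 96 * e / (42 / 25) by apply: divide hy; nra.
have hz' : z <= 96 * e / (67 / 100).
  by apply: divide hz; [lra | rewrite dE; nra].
by move: hx' hy' hz' e0; clear; lra.
Qed.

Lemma mid_mid_freq (R : realType) (X : 'I_4 -> 'M[R]_9) (e : R) f :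
  @SDP_feasible R 9 X -> (0 < f <= 4)%N ->
  1 - e <= orbit_mean path_edge (X (inord 0)) ->
  1 - 12 * e <= orbit_mean path_ends (X (inord 1)) ->
  (1 + 2 * turn_cos R 9 f) ^+ 2
    * (orbit_mean mid_mid (@freq_mx R 9 X f) + 1 / 2) <= 96 * e.
Proof.
move=> fX f4 T1 R2; have pF := psd_freq_mx fX f4; have [sF _] := pF.
have dF i := freq_mx_diag f i fX; have [_ rF] := SDP9_rows fX.
have rFf i := rF f i f4.
have nT := freq_orbit_near f orbit_path_edge fX T1.
have nR := freq_orbit_near f orbit_path_ends fX R2.
rewrite !inordK // muln1 in nT nR.
rewrite turn_cos_double in nR.
have cb : -1 <= turn_cos R 9 f <= 1 by rewrite -ler_norml; exact: cos_max.
apply: mid_mid_step cb _ _ (mid_row_sum sF dF rFf) (end_row_sum sF dF rFf)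
  (path_pair_form_ge0 (turn_cos R 9 f) pF dF).
  by move: nT; rewrite ler_distl.
by move: nR; rewrite ler_distl => /andP[_]; clear; lra.
Qed.

(** In [T1], [R1], [R2], [A3], [PQ1] and [PQ2], the letter is the orbit ([T]
    path edges, [R] ends of a path, [A] two middles, [P] and [Q] ends in the
    same and in opposite caps) and the digit is the distance; in [F3], [nR3],
    [P3], [Q3] and their companions for 4, the digit is the frequency. *)
Lemma SDP_theta_bound (R : realType) (X : 'I_4 -> 'M[R]_9) :
  @SDP_feasible R 9 X ->
  9 + 1 / 100 / 100 <= tour_cost (theta_lengths R) (X (inord 0)).
Proof.
move=> fX; have [sX nX _ _] := fX; have [rX _] := SDP9_rows fX.
have dX k i : X k i i = 0 by exact: SDP_feasible_diag.
have [_ bE dE ab] := turn_cos9 R.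
have pF f := @psd_freq_mx R 9 X f fX.
have dF f i := freq_mx_diag f i fX.
have total O : orbit_of 9 O ->
    orbit_mean O (X (inord 0)) + orbit_mean O (X (inord 1))
      + orbit_mean O (X (inord 2)) + orbit_mean O (X (inord 3)) = 1.
  move=> oO; have [O0 _] := oO.
  rewrite (SDP9_total (orbit_mean_linear O) fX) orbit_mean_ones //.
  by rewrite orbit_mean_id // subr0.
have x0 O k : 0 <= orbit_mean O (X k) by exact: orbit_mean_ge0.
rewrite (theta_costE (sX _) (dX _) (rX _)) leNgt; apply/negP => small.
(* From here on only [eE] and [e0] are known of [e]. *)
set e : R := 1 / 100 / 100 in small.
have eE : 100 * e = 1 / 100 by rewrite /e; lra.
have e0 : 0 <= e by rewrite /e; lra.
move: e eE e0 small => e eE e0 small.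
have mid1 := mid_row_sum (sX (inord 0)) (dX _) (rX _).
have end1 := end_row_sum (sX (inord 0)) (dX _) (rX _).
have mid2 := mid_row_sum (sX (inord 1)) (dX _) (rX _).
have end2 := end_row_sum (sX (inord 1)) (dX _) (rX _).
have T1 : 1 - e <= orbit_mean path_edge (X (inord 0)).
  move: (x0 path_ends (inord 0)) (x0 cross_cap (inord 0)) (x0 mid_mid (inord 0))
    (x0 mid_end (inord 0)) small mid1 e0; clear; lra.
have R1 : orbit_mean path_ends (X (inord 0)) <= e.
  move: (x0 path_ends (inord 0)) (x0 cross_cap (inord 0)) (x0 mid_mid (inord 0))
    (x0 mid_end (inord 0)) small e0; clear; lra.
have R2 : 1 - 12 * e <= orbit_mean path_ends (X (inord 1)).
  apply: (path_ends_step (T := orbit_mean path_edge (@freq_mx R 9 X 1)))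
    ab bE dE _ (total _ orbit_path_ends) R1 _ _; first by split.
    have := freq_orbit_near 1 orbit_path_edge fX T1.
    by rewrite inordK // ler_distl => /andP[].
  have := path_form_ge0 (turn_cos R 9 1) (pF 1%N isT) (dF 1%N).
  have [-> _ _ _] := freq9E X (orbit_mean_linear path_ends).
  by rewrite orbit_mean_id ?add0r //; exact: (proj1 orbit_path_ends).
(* The cosines [a], [b], [d] sum to zero, so adding the frequencies 1, 2 and 4
   leaves only the mass at distance 3. *)
have A3 : 1 - 145 * e <= orbit_mean mid_mid (X (inord 2)).
  have h1 := @mid_mid_freq R X e 1 fX isT T1 R2.
  have h2 := @mid_mid_freq R X e 2 fX isT T1 R2.
  have h4 := @mid_mid_freq R X e 4 fX isT T1 R2.
  have := mid_mid_total_step ab bE dE e0 h1 h2 h4.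
  have [-> -> _ ->] := freq9E X (orbit_mean_linear mid_mid).
  rewrite orbit_mean_id; last exact: (proj1 orbit_mid_mid).
  by move: e0; rewrite dE; clear; lra.
(* The rows of [X^(2)] are filled by the other distance-2 pairs. *)
have PQ2 : orbit_mean same_cap (X (inord 1))
    + orbit_mean cross_cap (X (inord 1)) <= 1 / 100.
  have tT := total _ orbit_path_edge; have tA := total _ orbit_mid_mid.
  have T2 : orbit_mean path_edge (X (inord 1)) <= e.
    move: (x0 path_edge (inord 2)) (x0 path_edge (inord 3)) tT T1.
    by clear; lra.
  have A2 : orbit_mean mid_mid (X (inord 1)) <= 145 * e.
    by move: (x0 mid_mid (inord 0)) (x0 mid_mid (inord 3)) tA A3; clear; lra.
  by move: T2 A2 R2 mid2 end2 (x0 path_edge (inord 1)) eE e0; clear; lra.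
have PQ1 : 49 / 100 <= orbit_mean same_cap (X (inord 0))
    - orbit_mean cross_cap (X (inord 0)).
  move: (x0 path_ends (inord 0)) (x0 cross_cap (inord 0))
    (x0 mid_mid (inord 0)) (x0 mid_end (inord 0)) small mid1 end1 eE.
  by clear; lra.
have F3 := orientation_form_ge0 (pF 3%N isT) (dF 3%N).
have F4 := orientation_form_ge0 (pF 4%N isT) (dF 4%N).
have nR3 := freq_orbit_near 3 orbit_path_ends fX R2.
have nR4 := freq_orbit_near 4 orbit_path_ends fX R2.
have [_ _ P3 P4] := freq9E X (orbit_mean_linear same_cap).
have [_ _ Q3 Q4] := freq9E X (orbit_mean_linear cross_cap).
have [iP _] := orbit_same_cap; have [iQ _] := orbit_cross_cap.
rewrite P3 Q3 !orbit_mean_id // !add0r in F3.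
rewrite P4 Q4 !orbit_mean_id // !add0r in F4.
apply: orientation_step ab bE dE (x0 _ _) (x0 _ _) PQ2 PQ1
  (total _ orbit_same_cap) (total _ orbit_cross_cap) _ _ F3 F4.
  have [c3 _ _ _] := turn_cos9 R; move: nR3; rewrite inordK //.
  rewrite (@turn_cosB R 9 3) // c3 ler_distl => /andP[+ _].
  by move: eE; clear; lra.
move: nR4; rewrite inordK // (@turn_cosB R 9 1) // ler_distl => /andP[+ _].
by move: eE; clear; lra.
Qed.

Lemma LP_lt_SDP_theta (R : realType) :
  (LP (theta_lengths R) < SDP (theta_lengths R))%E.
Proof.
apply: le_lt_trans (LP_theta_le R) _.
apply: (@lt_le_trans _ _ (9 + 1 / 100 / 100 : R)%:E).
  by rewrite lte_fin; lra.
apply: le_ereal_inf_tmp => _ /= [X [fX [k k0 ->]]]; rewrite lee_fin.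
have -> : k = inord 0 by apply: val_inj; rewrite /= inordK.
exact: SDP_theta_bound.
Qed.

Theorem theorem5 (R : realType) :
  (exists (n : nat) (D : 'M[R]_n),
     [/\ (3 <= n)%N, tsp_lengths D & (LP D < SDP D)%E]) /\
  (exists (n : nat) (D : 'M[R]_n),
     [/\ (3 <= n)%N, tsp_lengths D & (SDP D < LP D)%E]).
Proof.
split.
  exists 9%N, (theta_lengths R); split=> //; first exact: tsp_lengths_theta.
  exact: LP_lt_SDP_theta.
exists 6%N, (triangles_lengths R); split=> //.
  exact: tsp_lengths_triangles.
exact: SDP_lt_LP_triangles.
Qed.
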